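(* Let $R$ be a commutative Noetherian ring. If $V$ is a finitely generated FI-module over $R$ and $W$ is a sub-FI-module of $V$, then $W$ is finitely generated.
   Context: Let $\mathrm{FI}$ be the category whose objects are finite sets and whose morphisms are injections; $[n]=\{1,\dots,n\}$, $[0]=\emptyset$. For a commutative ring $R$, an FI-module over $R$ is a covariant functor $V$ from $\mathrm{FI}$ to the category of $R$-modules; write $V_S=V(S)$, $V_n=V([n])$, and $f_*=V(f)$ for an injection $f$. Morphisms of FI-modules are natural transformations. A sub-FI-module $W\subset V$ is a collection of $R$-submodules $W_S\subset V_S$, one for each finite set $S$, with $f_*(W_S)\subset W_T$ for every injection $f\colon S\to T$. An FI-module $V$ is finitely generated if there is a finite subset of $\coprod_{n\ge 0}V_n$ that is not contained in any proper sub-FI-module of $V$. *)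

(* Defs.v *)
From HB Require Import structures.
From mathcomp Require Import all_boot all_algebra.
From mathcomp Require Import boolp classical_sets cardinality.

Set Implicit Arguments.
Unset Strict Implicit.
Unset Printing Implicit Defensive.

Import GRing.Theory.
Local Open Scope classical_set_scope.
Local Open Scope ring_scope.

Definition is_ideal (R : comPzRingType) (I : set R) : Prop :=
  GRing.submod_closed [in (I : set R^o)].

(* [comPzRingType] allows the zero ring. *)
Definition noetherian (R : comPzRingType) : Prop :=
  forall I : set R, is_ideal I ->
    exists (n : nat) (g : 'I_n -> R),
      I = [set x | exists c : 'I_n -> R, x = \sum_(i < n) c i * g i].

(* Injections are bundled as finite functions with a boolean property, so that
   Leibniz equality of morphisms is pointwise equality. *)
Definition FIhom (S T : finType) : Type := {f : {ffun S -> T} | injectiveb f}.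

Definition FIfun (S T : finType) (f : FIhom S T) : S -> T := val f.
Coercion FIfun : FIhom >-> Funclass.

Lemma FIhom_inj (S T : finType) (f : FIhom S T) : injective f.
Proof. exact/injectiveP/(valP f). Qed.

Lemma FIid_subproof (S : finType) : injectiveb [ffun x : S => x].
Proof. by apply/injectiveP => x y; rewrite !ffunE. Qed.

Definition FIid (S : finType) : FIhom S S :=
  exist (fun f : {ffun S -> S} => injectiveb f) _ (FIid_subproof S).

Lemma FIcomp_subproof (S T U : finType) (g : FIhom T U) (f : FIhom S T) :
  injectiveb [ffun x => g (f x)].
Proof.
by apply/injectiveP => x y; rewrite !ffunE => /FIhom_inj /FIhom_inj.
Qed.

Definition FIcomp (S T U : finType) (g : FIhom T U) (f : FIhom S T) :
  FIhom S U :=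
  exist (fun f : {ffun S -> U} => injectiveb f) _ (FIcomp_subproof g f).

Record FImodule (R : comPzRingType) := MkFImodule {
  FIobj :> finType -> lmodType R;
  FImap : forall S T : finType, FIhom S T -> {linear FIobj S -> FIobj T};
  FImap_id : forall (S : finType) (x : FIobj S), FImap (FIid S) x = x;
  FImap_comp : forall (S T U : finType) (g : FIhom T U) (f : FIhom S T)
    (x : FIobj S), FImap (FIcomp g f) x = FImap g (FImap f x)
}.

Record subFImodule (R : comPzRingType) (V : FImodule R) := MkSubFImodule {
  subFI_set :> forall S : finType, set (V S);
  subFI_submod : forall S : finType, GRing.submod_closed [in @subFI_set S];
  subFI_map : forall (S T : finType) (f : FIhom S T) (x : V S),
    @subFI_set S x -> @subFI_set T (FImap V f x)
}.
Arguments subFI_set {R V} W S _ : rename.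

Definition proper_subFI (R : comPzRingType) (V : FImodule R)
    (W : subFImodule V) : Prop :=
  exists S : finType, W S <> [set: V S].

(* ['I_n] plays the role of the finite set [n], so the type of [A] is that of
   subsets of the disjoint union of the [V_n]. *)
Definition FI_finitely_generated (R : comPzRingType) (V : FImodule R) : Prop :=
  exists A : set {n : nat & V 'I_n},
    finite_set A /\
    ~ exists W : subFImodule V,
        proper_subFI W /\ A `<=` [set p | W 'I_(tag p) (tagged p)].

Definition subFI_pred (R : comPzRingType) (V : FImodule R)
  (W : subFImodule V) (S : finType) : {pred V S} := [in W S].
Arguments subFI_pred {R V} W S _.

HB.instance Definition _ (R : comPzRingType) (V : FImodule R)
    (W : subFImodule V) (S : finType) :=
  GRing.isSubmodClosed.Build R (V S) (subFI_pred W S) (subFI_submod W S).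

Definition subFI_obj (R : comPzRingType) (V : FImodule R)
  (W : subFImodule V) (S : finType) : Type := {x : V S | subFI_pred W S x}.

HB.instance Definition _ (R : comPzRingType) (V : FImodule R)
    (W : subFImodule V) (S : finType) := SubChoice.on (subFI_obj W S).
HB.instance Definition _ (R : comPzRingType) (V : FImodule R)
    (W : subFImodule V) (S : finType) :=
  [SubChoice_isSubLmodule of subFI_obj W S by <:].

Lemma subFI_fun_subproof (R : comPzRingType) (V : FImodule R)
    (W : subFImodule V) (S T : finType) (f : FIhom S T) (x : subFI_obj W S) :
  subFI_pred W T (FImap V f (val x)).
Proof. by apply/mem_set/subFI_map/set_mem; exact: (valP x). Qed.

Definition subFI_fun (R : comPzRingType) (V : FImodule R) (W : subFImodule V)
    (S T : finType) (f : FIhom S T) (x : subFI_obj W S) : subFI_obj W T :=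
  exist (subFI_pred W T) (FImap V f (val x)) (subFI_fun_subproof f x).

Lemma subFI_fun_linear (R : comPzRingType) (V : FImodule R)
    (W : subFImodule V) (S T : finType) (f : FIhom S T) :
  linear (@subFI_fun R V W S T f).
Proof. by move=> a x y; apply: val_inj; rewrite /= !linearP. Qed.

HB.instance Definition _ (R : comPzRingType) (V : FImodule R)
    (W : subFImodule V) (S T : finType) (f : FIhom S T) :=
  GRing.isLinear.Build R (subFI_obj W S) (subFI_obj W T) *:%R
    (@subFI_fun R V W S T f) (@subFI_fun_linear R V W S T f).

Lemma subFI_fun_id (R : comPzRingType) (V : FImodule R)
    (W : subFImodule V) (S : finType) (x : subFI_obj W S) :
  subFI_fun (FIid S) x = x.
Proof. by apply: val_inj; rewrite /= FImap_id. Qed.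

Lemma subFI_fun_comp (R : comPzRingType) (V : FImodule R)
    (W : subFImodule V) (S T U : finType) (g : FIhom T U) (f : FIhom S T)
    (x : subFI_obj W S) :
  subFI_fun (FIcomp g f) x = subFI_fun g (subFI_fun f x).
Proof. by apply: val_inj; rewrite /= FImap_comp. Qed.

Definition FImodule_of_sub (R : comPzRingType) (V : FImodule R)
    (W : subFImodule V) : FImodule R :=
  @MkFImodule R (fun S : finType => subFI_obj W S : lmodType R)
    (fun (S T : finType) (f : FIhom S T) =>
       @subFI_fun R V W S T f : {linear subFI_obj W S -> subFI_obj W T})
    (@subFI_fun_id R V W) (@subFI_fun_comp R V W).

(* Main.v *)
(* A Groebner basis argument. Let V be generated by a_i in V_{d_i}, i < K. The
   vectors f_* a_i, for injections f : [d_i] -> [n], span V_n; order these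
   "monomials" (i, f) lexicographically by (i, f 1, ..., f d_i). Pushing forward
   along an increasing h : [n] -> [n'] preserves this order, so the ideals
   lead W m of coefficients at m of elements of W supported on monomials <= m
   grow when m is pushed forward. A monomial divides (is pushed to) another as
   soon as finitely many natural number coordinates are <=, so Dickson's lemma
   and the ascending chain condition yield finitely many monomials m0 such that
   every m is divisible by some m0 with lead W m = lead W m0. Elements of W
   witnessing generators of these lead W m0 generate W, by induction on the
   largest monomial. No linear independence of monomials is needed, so the
   argument runs in V itself. *)

Require Import Defs.
From mathcomp Require Import all_boot all_order all_algebra.
From mathcomp Require Import boolp classical_sets cardinality.
From mathcomp Require Import zify.

Set Implicit Arguments.
Unset Strict Implicit.
Unset Printing Implicit Defensive.

Import Order.TTheory GRing.Theory.
Local Open Scope classical_set_scope.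
Local Open Scope ring_scope.

(** * Monotone subsequences and finite bases *)

Lemma nat_monotone_subseq (u : nat -> nat) :
  exists2 phi : nat -> nat, {homo phi : i j / (i < j)%N} &
    {homo u \o phi : i j / (i <= j)%N}.
Proof.
(* Every tail of [u] attains its minimum; choosing such indices one after another makes the values
   weakly increase. *)
have minu N : exists k, (N <= k)%N /\ forall l, (N <= l)%N -> (u k <= u l)%N.
  have exu : exists v, `[< exists2 k, (N <= k)%N & u k = v >].
    by exists (u N); apply/asboolP; exists N.
  case: (ex_minnP exu) => v /asboolP[k Nk <-] min_v.
  by exists k; split=> // l Nl; apply/min_v/asboolP; exists l.
have /choice[g gP] := minu.
pose phi := nat_rect (fun=> nat) (g 0%N) (fun _ k => g k.+1).
have phiS i : (phi i < phi i.+1)%N by case: (gP (phi i).+1).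
have phi_min i l : (phi i <= l)%N -> (u (phi i) <= u l)%N.
  by case: i => [|i] phi_l; [apply: (gP 0%N).2 | apply: (gP (phi i).+1).2;
    apply: leq_trans phi_l; apply: (gP (phi i).+1).1].
exists phi; first by apply: homo_ltn phiS => j i k; apply: ltn_trans.
apply: homo_leq => [i|j i k|i] //=; first exact: leq_trans.
exact/phi_min/ltnW.
Qed.

(* Dickson's lemma. *)
Lemma monotone_subseq (C : finType) (u : nat -> C -> nat) :
  exists2 phi : nat -> nat, {homo phi : i j / (i < j)%N} &
    forall c, {homo (fun i => u (phi i) c) : i j / (i <= j)%N}.
Proof.
suff [phi phi_mono uP] : exists2 phi : nat -> nat,
    {homo phi : i j / (i < j)%N} &
    forall c, c \in enum C -> {homo (fun i => u (phi i) c) : i j / (i <= j)%N}.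
  by exists phi => // c; apply: uP; rewrite mem_enum.
elim: (enum C) => [|c s [phi phi_mono uP]]; first by exists id.
have [psi psi_mono cP] := nat_monotone_subseq (fun i => u (phi i) c).
exists (phi \o psi) => [i j ij|c']; first exact/phi_mono/psi_mono.
rewrite inE => /predU1P[-> //|/uP c'P] i j ij; apply: c'P.
exact: (ltnW_homo psi_mono).
Qed.

(** Otherwise every finite list leaves out some term that none of its members reaches. Adjoining
    such terms one at a time gives a sequence in which no earlier term is [P]-related to a later
    one. *)
Lemma finite_basis_of_good (T : eqType) (P : T -> T -> Prop) :
  (forall u : nat -> T, exists i j, (i < j)%N /\ P (u i) (u j)) ->
  exists F : seq T, forall m, exists2 m0, m0 \in F & P m0 m.
Proof.
move=> good; apply: contrapT => noF.
have bad (F : seq T) : exists m, forall m0, m0 \in F -> ~ P m0 m.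
  apply: contrapT => badF; apply: noF; exists F => m.
  apply: contrapT => noP; apply: badF; exists m => m0 m0F m0P.
  by apply: noP; exists m0.
have /choice[g gP] := bad.
pose F := nat_rect (fun=> seq T) [::] (fun _ s => g s :: s).
have subF i j : (i <= j)%N -> {subset F i <= F j}.
  apply: (homo_leq (r := fun s t => {subset s <= t})) => {i j}
    [s|t s r st tr|i] x //.
    by move=> /st /tr.
  by rewrite inE => ->; rewrite orbT.
have [i [j [ij]]] := good (g \o F).
by apply: gP; apply: (subF i.+1) => //=; rewrite inE eqxx.
Qed.

(** * Submodules and spans *)

Section Span.
Context (R : pzRingType) (M : lmodType R).
Implicit Types (B P : set M).

(** A propositional form of [GRing.submod_closed], which avoids the boolean membership [[in P]]. *)
Definition is_submod (P : set M) :=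
  P 0 /\ forall (a : R) x y, P x -> P y -> P (a *: x + y).

Lemma is_submodE (P : set M) : is_submod P <-> GRing.submod_closed [in P].
Proof.
split=> -[P0 PD]; split; rewrite -?[P _]mem_setE; first exact/mem_set.
- by move=> a x y /set_mem Px /set_mem Py; apply/mem_set/PD.
- exact: set_mem.
by move=> a x y /mem_set Px /mem_set Py; apply/set_mem/PD.
Qed.

Lemma is_submod0 P : is_submod P -> P 0. Proof. by case. Qed.

Lemma is_submodL P (a : R) x y :
  is_submod P -> P x -> P y -> P (a *: x + y).
Proof. by move=> [_ PD]; apply: PD. Qed.

Lemma is_submodZ P a x : is_submod P -> P x -> P (a *: x).
Proof. by move=> [P0 PD] Px; rewrite -[_ *: _]addr0; apply: PD. Qed.

Lemma is_submodD P x y : is_submod P -> P x -> P y -> P (x + y).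
Proof. by move=> [_ PD] Px Py; rewrite -[x]scale1r; apply: PD. Qed.

Lemma is_submodB P x y : is_submod P -> P x -> P y -> P (x - y).
Proof.
move=> subP Px Py; rewrite -scaleN1r.
by apply: is_submodD => //; apply: is_submodZ.
Qed.

Lemma is_submod_sum P n (c : 'I_n -> R) (v : 'I_n -> M) : is_submod P ->
  (forall i, P (v i)) -> P (\sum_(i < n) c i *: v i).
Proof.
move=> subP Pv; elim/big_ind: _ => [|x y|i _]; first exact: is_submod0.
- exact: is_submodD.
- exact: is_submodZ.
Qed.

Definition submod_span : set M -> set M := smallest is_submod.

Lemma submod_spanP B : is_submod (submod_span B).
Proof.
split=> [P [[]] //|a x y xB yB P PB].
by case: (PB) => -[_ PD] _; apply: PD; [apply: xB | apply: yB].
Qed.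

Lemma submod_span0 B : submod_span B 0.
Proof. exact: is_submod0 (submod_spanP B). Qed.

Lemma submod_spanL B a x y :
  submod_span B x -> submod_span B y -> submod_span B (a *: x + y).
Proof. exact: (is_submodL a (submod_spanP B)). Qed.

Lemma sub_submod_span B : B `<=` submod_span B.
Proof. exact: sub_gen_smallest. Qed.

Lemma submod_span_sub P B : is_submod P -> B `<=` P -> submod_span B `<=` P.
Proof. exact: smallest_sub. Qed.

Lemma submod_span_mono B B' : B `<=` B' -> submod_span B `<=` submod_span B'.
Proof.
move=> sBB'; apply: submod_span_sub (submod_spanP _) _ => x.
by move=> /sBB'/sub_submod_span.
Qed.

End Span.

Lemma is_submod_preimage (R : pzRingType) (M N : lmodType R)
    (f : {linear M -> N}) (P : set N) :
  is_submod P -> is_submod (f @^-1` P).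
Proof.
move=> [P0 PD]; split=> [|a x y]; rewrite /preimage /= ?linear0 ?linearP //.
exact: PD.
Qed.

(** * Ideals and the ascending chain condition *)

Lemma is_idealE (R : comPzRingType) (I : set R) :
  is_ideal I <-> is_submod (I : set R^o).
Proof. exact: iff_sym (is_submodE _). Qed.

(** The union of the chain is a finitely generated ideal, and its finitely many generators all lie
    in a single [I N]. *)
Lemma noetherian_acc (R : comPzRingType) (I : nat -> set R) :
  noetherian R -> (forall k, is_ideal (I k)) ->
  {homo I : i j / (i <= j)%N >-> i `<=` j} -> exists N, I N.+1 `<=` I N.
Proof.
move=> hR idI monoI; pose U : set R := \bigcup_k I k.
have subI k : is_submod (I k : set R^o) by apply/is_idealE.
have /hR[n [g Ug]] : is_ideal U.
  apply/is_idealE; split=> [|a x y [i _ xi] [j _ yj]].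
    by exists 0%N => //; apply: (subI 0%N).1.
  exists (maxn i j) => //; apply: (subI _).2.
  - exact: monoI (leq_maxl i j) _ xi.
  - exact: monoI (leq_maxr i j) _ yj.
have gU i : exists k, I k (g i).
  suff [k _ ?] : U (g i) by exists k.
  rewrite Ug; exists (fun j => (j == i)%:R).
  rewrite (bigD1 i) //= eqxx mul1r big1 ?addr0 // => j /negPf ->.
  by rewrite mul0r.
have /choice[k kP] := gU.
exists (\max_i k i) => r rI.
have : U r by exists (\max_i k i).+1.
rewrite Ug => -[c ->]; apply: (@is_submod_sum R R^o _ n c g) (subI _) _ => i.
exact: monoI (leq_bigmax i) _ (kP i).
Qed.

(** * Injections and increasing maps *)

Lemma FIhom_eqP (S T : finType) (f g : FIhom S T) : f =1 g <-> f = g.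
Proof. by split=> [fg|-> //]; apply/val_inj/ffunP. Qed.

Definition FIhom_of (S T : finType) (h : S -> T) (h_inj : injective h) :
  FIhom S T.
Proof.
exists [ffun x => h x]; apply/injectiveP => x y; rewrite !ffunE; exact: h_inj.
Defined.

Lemma FIhom_ofE (S T : finType) (h : S -> T) (h_inj : injective h) :
  FIhom_of h_inj =1 h.
Proof. by move=> x; rewrite /FIfun /= ffunE. Qed.

Lemma FIcompE (S T U : finType) (g : FIhom T U) (f : FIhom S T) x :
  FIcomp g f x = g (f x).
Proof. by rewrite {1}/FIfun /= ffunE. Qed.

Definition increasing n n' (h : 'I_n -> 'I_n') :=
  {homo h : x y / (x < y)%N}.

(** Let [h] move [y] by the largest displacement [f' x - f x] among the [x] with [f x <= y]. Gaps do
    not shrink from [f] to [f'], so displacements grow with [f x] and the maximum at [f x] is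
    attained at [x] itself. The two comparisons of [n] with [n'] keep [h] below [n']. *)
Lemma increasing_factor d n n' (f : FIhom 'I_d 'I_n) (f' : FIhom 'I_d 'I_n') :
  (n <= n')%N -> (forall x, f x <= f' x)%N ->
  (forall x y, f y - f x <= f' y - f' x)%N ->
  (forall x, n - f x <= n' - f' x)%N ->
  exists2 h : FIhom 'I_n 'I_n', increasing h & FIcomp h f = f'.
Proof.
move=> nn' ff' dff' nff'.
pose shift (y : nat) := (\max_(x < d | f x <= y) (f' x - f x))%N.
have shift_mono y z : (y <= z)%N -> (shift y <= shift z)%N.
  move=> yz; apply/bigmax_leqP => x fxy.
  by apply: leq_bigmax_cond; apply: leq_trans yz.
have h_subproof (y : 'I_n) : (y + shift y < n')%N.
  suff : (shift y <= n'.-1 - y)%N by have := ltn_ord y; lia.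
  apply/bigmax_leqP => x fxy.
  have := ltn_ord y; have := ltn_ord (f' x); have := nff' x; lia.
pose h y := Ordinal (h_subproof y).
have h_incr : increasing h.
  by move=> x y /= xy; have := shift_mono x y (ltnW xy); lia.
have h_inj : injective h.
  move=> x y hxy; apply/val_inj.
  by case: (ltngtP x y) => // /h_incr; rewrite hxy ltnn.
exists (FIhom_of h_inj).
  by move=> x y xy; rewrite !FIhom_ofE; apply: h_incr.
apply/FIhom_eqP => x; rewrite FIcompE FIhom_ofE; apply/val_inj => /=.
suff -> : shift (f x) = (f' x - f x)%N by rewrite subnKC.
apply/eqP; rewrite eqn_leq; apply/andP; split; last exact: leq_bigmax_cond.
apply/bigmax_leqP => y; rewrite leq_eqVlt.
case/predU1P=> [/val_inj/FIhom_inj -> //|fyx].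
by have := dff' y x; have := ff' x; have := ff' y; lia.
Qed.

Lemma map_increasing_lexi n n' (h : 'I_n -> 'I_n') (s t : seq 'I_n) :
  increasing h ->
  (map val s < map val t :> seqlexi nat)%O ->
  (map (val \o h) s < map (val \o h) t :> seqlexi nat)%O.
Proof.
move=> h_incr; elim: s t => [|x s IHs] [|y t] //=.
rewrite !ltxi_cons /= !leEnat => /andP[xy /implyP st].
have hxy : (h x <= h y)%N.
  by move: xy; rewrite leq_eqVlt => /predU1P[/val_inj->//|/h_incr/ltnW].
rewrite hxy /=; apply/implyP.
case: (ltngtP x y) xy => // [/h_incr|/val_inj xy _ _].
  by rewrite ltnNge => /negbTE ->.
by apply/IHs/st; rewrite xy.
Qed.

(** * Monomials, their order and divisibility *)

Section Monomials.
Context (R : comPzRingType) (V : FImodule R).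
Context (K : nat) (d : 'I_K -> nat) (a : forall i, V 'I_(d i)).

Definition monomial n := {i : 'I_K & FIhom 'I_(d i) 'I_n}.

Definition monomial_val n (m : monomial n) : V 'I_n :=
  FImap V (tagged m) (a (tag m)).

Definition word n (m : monomial n) : seq 'I_n :=
  [seq tagged m x | x <- enum 'I_(d (tag m))].

Definition monomial_key n (m : monomial n) : seqlexi nat :=
  (tag m : nat) :: map val (word m).

Definition monomial_lt n (m m' : monomial n) :=
  (monomial_key m < monomial_key m')%O.

Definition push n n' (h : FIhom 'I_n 'I_n') (m : monomial n) : monomial n' :=
  existT _ (tag m) (FIcomp h (tagged m)).

Lemma monomial_key_inj n : injective (@monomial_key n).
Proof.
move=> [i f] [j g] [] /= /val_inj eij; case: j / eij g => g.
move=> /(inj_map val_inj)/eq_in_map fg; congr existT; apply/FIhom_eqP => x.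
by apply: fg; rewrite mem_enum.
Qed.

Lemma monomial_val_push n n' (h : FIhom 'I_n 'I_n') (m : monomial n) :
  monomial_val (push h m) = FImap V h (monomial_val m).
Proof. exact: FImap_comp. Qed.

Lemma word_push n n' (h : FIhom 'I_n 'I_n') (m : monomial n) :
  word (push h m) = map h (word m).
Proof. by rewrite /word -map_comp; apply: eq_map => x /=; rewrite FIcompE. Qed.

Lemma monomial_lt_push n n' (h : FIhom 'I_n 'I_n') (m m' : monomial n) :
  increasing h -> monomial_lt m m' -> monomial_lt (push h m) (push h m').
Proof.
move=> h_incr; rewrite /monomial_lt /monomial_key !word_push !ltxi_cons /=.
case/andP=> -> /implyP mm' /=; apply/implyP => /mm'.
move/(map_increasing_lexi h_incr).
by rewrite -!map_comp.
Qed.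

Definition divides n n' (m : monomial n) (m' : monomial n') :=
  exists2 h : FIhom 'I_n 'I_n', increasing h & push h m = m'.

(** Dickson's lemma needs one finite set of coordinates for all monomials, so the word lengths get a
    common bound. *)
Let D := (\max_i d i)%N.

(* Entries past the end of the word, in particular the one at [D], are [n]. *)
Definition entry n (m : monomial n) (b : 'I_D.+1) : nat :=
  nth n (map val (word m)) b.

Definition ord_entry i (x : 'I_(d i)) : 'I_D.+1 :=
  widen_ord (leqW (leq_bigmax i)) x.

Lemma entryE n (m : monomial n) x : entry m (ord_entry x) = tagged m x.
Proof.
rewrite /entry /word -map_comp (nth_map x) ?size_enum_ord//=.
by congr (nat_of_ord (tagged m _)); apply/val_inj; rewrite /= nth_enum_ord.
Qed.

Lemma entry_max n (m : monomial n) : entry m ord_max = n.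
Proof.
rewrite /entry nth_default // /word 2!size_map size_enum_ord /=.
exact: (leq_bigmax (tag m)).
Qed.

(* The coordinates on which divisibility is coordinatewise comparison; the
   generator is compared in both directions, so that it is preserved. *)
Definition coordinate n (m : monomial n)
    (c : bool + ('I_D.+1 + 'I_D.+1 * 'I_D.+1)) : nat :=
  match c with
  | inl true => tag m
  | inl false => K - tag m
  | inr (inl x) => entry m x
  | inr (inr (x, y)) => entry m y - entry m x
  end%N.

Lemma coordinate_divides n n' (m : monomial n) (m' : monomial n') :
  (forall c, coordinate m c <= coordinate m' c)%N -> divides m m'.
Proof.
case: m m' => i f [j f'] le_mm'.
have eij : i = j.
  have := le_mm' (inl true); have := le_mm' (inl false).
  have := ltn_ord i; have := ltn_ord j.
  by move=> /= *; apply/val_inj => /=; lia.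
case: j / eij f' le_mm' => f' le_mm'.
(* The two conditions on [n] and [n'] are read off at [ord_max], where the entries are [n] and
   [n']. *)
have [||||h h_incr hf] := @increasing_factor _ _ _ f f'.
- by have := le_mm' (inr (inl ord_max)); rewrite /= !entry_max.
- by move=> x; have := le_mm' (inr (inl (ord_entry x))); rewrite /= !entryE.
- move=> x y; have := le_mm' (inr (inr (ord_entry x, ord_entry y))).
  by rewrite /= !entryE.
- move=> x; have := le_mm' (inr (inr (ord_entry x, ord_max))).
  by rewrite /= !entryE !entry_max.
by exists h => //; rewrite /push /= hf.
Qed.

Definition lower n (m : monomial n) : set (V 'I_n) :=
  @monomial_val n @` [set m' | monomial_lt m' m].

Definition lower_eq n (m : monomial n) : set (V 'I_n) :=
  @monomial_val n @` [set m' | (monomial_key m' <= monomial_key m)%O].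

Lemma span_lower_push n n' (h : FIhom 'I_n 'I_n') (m : monomial n) x :
  increasing h -> submod_span (lower m) x ->
  submod_span (lower (push h m)) (FImap V h x).
Proof.
pose P := FImap V h @^-1` submod_span (lower (push h m)).
move=> h_incr; apply: (submod_span_sub (P := P)) => [|_ [m' m'm <-]].
  exact/is_submod_preimage/submod_spanP.
rewrite /P /preimage /= -monomial_val_push; apply: sub_submod_span.
by exists (push h m') => //; apply: monomial_lt_push.
Qed.

(** By injectivity of the key, [m] is the only monomial of [lower_eq m] outside [lower m]. The
    coefficient [r] need not be unique, since monomials may be linearly dependent. *)
Lemma span_lower_eq n (m : monomial n) x : submod_span (lower_eq m) x ->
  exists r y, submod_span (lower m) y /\ x = r *: monomial_val m + y.
Proof.
apply: (submod_span_sub (P := [set x | exists r y, _])) => [|_ [m' m'm <-]].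
  split=> [|b _ _ [r [y [ly ->]]] [s [z [lz ->]]]].
    by exists 0, 0; split; [exact: submod_span0 | rewrite scale0r addr0].
  exists (b * r + s), (b *: y + z); split; first exact: submod_spanL.
  by rewrite scalerDr scalerDl scalerA addrACA.
move: m'm; rewrite /= le_eqVlt => /predU1P[/monomial_key_inj ->|m'm].
  by exists 1, 0; split; [exact: submod_span0 | rewrite scale1r addr0].
exists 0, (monomial_val m'); split; last by rewrite scale0r add0r.
by apply: sub_submod_span; exists m'.
Qed.

(* The spans of [lower_eq m'] form a chain, so their union is a submodule. *)
Lemma span_chain n (P : pred (monomial n)) x :
  submod_span (@monomial_val n @` [set m | P m]) x ->
  x = 0 \/ exists2 m, P m & submod_span (lower_eq m) x.
Proof.
apply: (submod_span_sub
  (P := [set x | x = 0 \/ exists2 m, P m & submod_span (lower_eq m) x])) =>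
  [|_ [m Pm <-]]; last first.
  by right; exists m => //; apply: sub_submod_span; exists m => /=.
have lower_eqS m m' : (monomial_key m <= monomial_key m')%O ->
    submod_span (lower_eq m) `<=` submod_span (@lower_eq n m').
  move=> mm'; apply: submod_span_mono => _ [m1 m1m <-].
    by exists m1 => //=; apply: le_trans mm'.
split=> [|b y z]; first by left.
move=> [->|[m Pm ly]]; first by rewrite scaler0 add0r.
move=> [->|[m' Pm' lz]].
  rewrite addr0; right; exists m => //.
  exact: is_submodZ (submod_spanP _) ly.
right; have [mm'|/ltW m'm] := leP (monomial_key m) (monomial_key m').
  by exists m' => //; apply: submod_spanL lz; apply: lower_eqS ly.
by exists m => //; apply: submod_spanL ly _; apply: lower_eqS lz.
Qed.

(** * Ideals of leading coefficients *)

Section Leading.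
Variable (W : subFImodule V).

Lemma subFI_is_submod S : is_submod (W S).
Proof. exact/is_submodE/subFI_submod. Qed.

Definition lead n (m : monomial n) : set R :=
  [set r | exists2 y,
    submod_span (lower m) y & W 'I_n (r *: monomial_val m + y)].

Lemma lead_ideal n (m : monomial n) : is_ideal (lead m).
Proof.
apply/is_idealE; split=> [|b r s [y ly Wy] [z lz Wz]].
  exists 0; first exact: submod_span0.
  by rewrite scale0r addr0; exact: is_submod0 (subFI_is_submod _).
exists (b *: y + z); first exact: submod_spanL.
have := is_submodL b (subFI_is_submod _) Wy Wz.
by rewrite scalerDr scalerA addrACA -scalerDl.
Qed.

Lemma lead_divides n n' (m : monomial n) (m' : monomial n') :
  divides m m' -> lead m `<=` lead m'.
Proof.
move=> [h h_incr <-] r [y ly Wy]; exists (FImap V h y).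
  exact: span_lower_push.
by rewrite monomial_val_push -linearP; apply: subFI_map.
Qed.

End Leading.

(** Lift each of finitely many generators of [lead W m] to an element of [W] having it as leading
    coefficient; combinations of these lifts realize the whole ideal inside any [U] that contains
    them. *)
Lemma lead_finite_witness (W : subFImodule V) n (m : monomial n) :
  noetherian R ->
  exists2 A : set (V 'I_n), finite_set A /\ A `<=` W 'I_n &
    forall U : subFImodule V, A `<=` U 'I_n -> lead W m `<=` lead U m.
Proof.
move=> hR; have [k [g Wg]] := hR _ (lead_ideal W m).
have gW j : exists y,
    submod_span (lower m) y /\ W 'I_n (g j *: monomial_val m + y).
  suff [y] : lead W m (g j) by exists y.
  rewrite Wg; exists (fun i => (i == j)%:R).
  rewrite (bigD1 j) //= eqxx mul1r big1 ?addr0 // => i /negPf ->.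
  by rewrite mul0r.
have /choice[y yP] := gW.
exists [set g j *: monomial_val m + y j | j in [set: 'I_k]].
  split=> [|_ [j _ <-]]; last exact: (yP j).2.
  exact/finite_image/finite_finset.
move=> U AU r; rewrite Wg => -[c ->]; exists (\sum_(j < k) c j *: y j).
  by apply: is_submod_sum => [|j]; [exact: submod_spanP | exact: (yP j).1].
rewrite scaler_suml -big_split /=.
under eq_bigr do rewrite -scalerA -scalerDr.
by apply: is_submod_sum => [|j]; [exact: subFI_is_submod | apply: AU; exists j].
Qed.

(** Division algorithm: subtract from an element of [W] an element of [U] with the same leading
    term. The remainder stays in [W] because [U] lies in [W], and it involves smaller monomials
    only. *)
Lemma sub_of_lead (U W : subFImodule V) n :
  U 'I_n `<=` W 'I_n -> (forall m : monomial n, lead W m `<=` lead U m) ->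
  submod_span (range (@monomial_val n)) `&` W 'I_n `<=` U 'I_n.
Proof.
move=> UW leadWU.
(* For fixed [n] there are finitely many monomials, so the number of those below [m] can serve as
   induction measure. *)
suff below k (m : monomial n) : (#|[pred m' | monomial_lt m' m]| < k)%N ->
    submod_span (lower_eq m) `&` W 'I_n `<=` U 'I_n.
  move=> x [sx Wx].
  have [|->|[m _ mx]] := @span_chain n predT x; last exact: (below _ m).
    by apply: submod_span_mono sx => _ [m _ <-]; exists m.
  exact: is_submod0 (subFI_is_submod U _).
elim: k m => // k IHk m mk x [/span_lower_eq[r [y [ly xE]]] Wx].
have [z lz Uz] : lead U m r by apply: leadWU; exists y; rewrite -?xE.
have -> : x = (r *: monomial_val m + z) + (y - z).
  by rewrite xE addrACA subrr addr0.
apply: (is_submodD (subFI_is_submod U _) Uz).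
have Wyz : W 'I_n (y - z).
  have -> : y - z = x - (r *: monomial_val m + z).
    by rewrite xE opprD addrACA subrr add0r.
  exact: (is_submodB (subFI_is_submod W _) Wx (UW _ Uz)).
have lyz : submod_span (lower m) (y - z).
  exact: (is_submodB (submod_spanP _) ly lz).
(* A nonzero remainder has its monomials bounded by a single [m'] strictly below [m]. *)
have [->|[m' m'm lm']] := span_chain lyz.
  exact: is_submod0 (subFI_is_submod U _).
apply: (IHk m'); last by split.
rewrite ltnS in mk; apply: leq_trans mk; apply/proper_card/properP; split.
  apply/fintype.subsetP => m1; rewrite !inE => m1m'.
  exact: lt_trans m1m' m'm.
by exists m'; rewrite !inE // /monomial_lt ltxx.
Qed.

(** Any sequence of monomials has a subsequence in which each term divides the later ones. The lead
    ideals ascend along it, so two consecutive ones agree by the chain condition. *)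
Lemma finite_leads (W : subFImodule V) : noetherian R ->
  exists F : seq {n & monomial n}, forall m, exists2 m0, m0 \in F &
    divides (tagged m0) (tagged m) /\ lead W (tagged m) `<=` lead W (tagged m0).
Proof.
move=> hR; apply: finite_basis_of_good => u.
have [phi phi_mono uP] := monotone_subseq (fun i => coordinate (tagged (u i))).
have div_u i j : (i <= j)%N ->
    divides (tagged (u (phi i))) (tagged (u (phi j))).
  by move=> ij; apply: coordinate_divides => c; apply: uP.
have [|i j /div_u/lead_divides//|N leadN] :=
  noetherian_acc (I := fun i => lead W (tagged (u (phi i)))) hR.
  by move=> k; apply: lead_ideal.
exists (phi N), (phi N.+1); split; first exact: phi_mono.
by split; first exact: div_u.
Qed.

End Monomials.

(** * From spanning monomials to finite generation *)

Section Generation.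
Context (R : comPzRingType) (V : FImodule R).

(** Transport [x] to ['I_#|S|] along [enum_rank], and back along its inverse [enum_val]. *)
Lemma subFI_le_skeleton (W U : subFImodule V) :
  (forall n, W 'I_n `<=` U 'I_n) -> forall S, W S `<=` U S.
Proof.
move=> WU S x Wx.
have <- : FImap V (FIhom_of (@enum_val_inj S _))
    (FImap V (FIhom_of (@enum_rank_inj S)) x) = x.
  rewrite -FImap_comp -[RHS](FImap_id (S := S)); congr (FImap V _ x).
  apply/FIhom_eqP => y; rewrite FIcompE !FIhom_ofE enum_rankK.
  by rewrite /FIfun /= ffunE.
by apply/subFI_map/WU/subFI_map.
Qed.

Section Generators.
Variables (K : nat) (d : 'I_K -> nat) (a : forall i, V 'I_(d i)).

Definition generated_set (S : finType) : set (V S) := submod_span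
  (range (fun p : {i : 'I_K & FIhom 'I_(d i) S} =>
            FImap V (tagged p) (a (tag p)))).

Lemma generated_submod S : GRing.submod_closed [in @generated_set S].
Proof. exact: (is_submodE _).1 (submod_spanP _). Qed.

Lemma generated_map (S T : finType) (f : FIhom S T) (x : V S) :
  generated_set x -> generated_set (FImap V f x).
Proof.
apply: (submod_span_sub (P := FImap V f @^-1` @generated_set T)) =>
  [|_ [[i g] _ <-]].
  exact: is_submod_preimage (submod_spanP _).
rewrite /preimage /= -FImap_comp; apply: sub_submod_span.
by exists (existT _ i (FIcomp f g)).
Qed.

Definition generated_subFI : subFImodule V :=
  MkSubFImodule generated_submod generated_map.

Lemma finite_witness (W : subFImodule V) : noetherian R ->
  (forall n, generated_set (S := 'I_n) = setT) ->
  exists2 A : set {n & V 'I_n},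
    finite_set A /\ A `<=` [set p | W 'I_(tag p) (tagged p)] &
    forall U : subFImodule V, (forall S, U S `<=` W S) ->
      A `<=` [set p | U 'I_(tag p) (tagged p)] -> forall S, W S `<=` U S.
Proof.
move=> hR genV; have [F FP] := finite_leads a W hR.
have witness (m : {n & monomial d n}) :
    exists A : set (V 'I_(tag m)), [/\ finite_set A, A `<=` W 'I_(tag m) &
      forall U : subFImodule V, A `<=` U 'I_(tag m) ->
        lead a W (tagged m) `<=` lead a U (tagged m)].
  by have [A [? ?] ?] := lead_finite_witness a W (tagged m) hR; exists A.
pose A m := projT1 (cid (witness m)).
have AP m := projT2 (cid (witness m)).
exists (\bigcup_(m in [set` F])
          existT (fun n => V 'I_n : Type) (tag m) @` A m).
  split=> [|_ [m _ [x Ax <-]]]; last by have [_ AW _] := AP m; apply: AW.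
  apply: bigcup_finite => [|m _]; first exact: finite_seq.
  by apply: finite_image; case: (AP m).
move=> U UW AU; apply: subFI_le_skeleton => n x Wx.
apply: (sub_of_lead (a := a) (W := W)) => [|m|]; first exact: UW; last first.
  (* At ['I_n], [generated_set] unfolds to the span of all monomial values. *)
  by split=> //; rewrite -[submod_span _]/(@generated_set 'I_n) genV.
have [m0 m0F [m0m leadm0]] := FP (existT _ n m).
have [_ _ AU0] := AP m0.
(* The chain is [lead W m], [lead W m0], [lead U m0], [lead U m], each included in the next. *)
apply: subset_trans leadm0 _; apply: subset_trans (lead_divides m0m).
apply: AU0 => y Ay; apply: (AU (existT _ (tag m0) y)).
by exists m0 => //; exists y.
Qed.

End Generators.

(** If the translates of the finite set failed to span some [V S], they would generate a proper
    sub-FI-module containing that set. *)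
Lemma generators_of_fg : FI_finitely_generated V ->
  exists K (d : 'I_K -> nat) (a : forall i, V 'I_(d i)),
    forall S, generated_set a (S := S) = setT.
Proof.
move=> [A [/finite_seqP[s ->] noW]].
exists (size s), (fun i => tag (tnth (in_tuple s) i)),
  (fun i => tagged (tnth (in_tuple s) i)) => S.
apply: contrapT => properS; apply: noW.
exists (generated_subFI (fun i => tagged (tnth (in_tuple s) i))).
split; first by exists S.
move=> p /= /seq_tnthP[i ->]; apply: sub_submod_span.
by exists (existT _ i (FIid _)) => //=; exact: FImap_id.
Qed.

(** * Sub-FI-modules of [W] viewed inside [V] *)

Section SubSub.
Variables (W : subFImodule V) (U : subFImodule (FImodule_of_sub W)).

Definition subsub_set S : set (V S) := [set val x | x in U S].

Lemma subsub_submod S : GRing.submod_closed [in @subsub_set S].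
Proof.
apply: (is_submodE (@subsub_set S)).1; split=> [|b _ _ [x Ux <-] [y Uy <-]].
  by exists 0 => //; exact: is_submod0 (subFI_is_submod U S).
by exists (b *: x + y) => //; exact: is_submodL (subFI_is_submod U S) Ux Uy.
Qed.

Lemma subsub_map (S T : finType) (f : FIhom S T) (x : V S) :
  subsub_set x -> subsub_set (FImap V f x).
Proof.
by move=> [y Uy <-]; exists (subFI_fun f y) => //; apply: (subFI_map f Uy).
Qed.

Definition subsub : subFImodule V := MkSubFImodule subsub_submod subsub_map.

End SubSub.

End Generation.

Theorem theoremA (R : comPzRingType) (hR : noetherian R) (V : FImodule R)
    (hV : FI_finitely_generated V) (W : subFImodule V) :
  FI_finitely_generated (FImodule_of_sub W).
Proof.
have [K [d [a genV]]] := generators_of_fg hV.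
have [A [finA AW] AP] := finite_witness W hR (fun n => genV 'I_n).
pose incl (p : {n & subFI_obj W 'I_n}) : {n & V 'I_n} :=
  existT _ (tag p) (val (tagged p)).
(* Finiteness passes to the preimage because [incl] is injective. *)
exists (incl @^-1` A); split.
  apply: finite_preimage finA => -[n x] [m y] _ _ /= E.
  have nm : n = m := congr1 tag E; case: m / nm y E => y E.
  by move/eqP: E; rewrite eq_Tagged /= => /eqP/val_inj ->.
move=> [U [[S properS] AU]]; apply: properS; apply/seteqP; split=> // x _.
(* The image of [U] in [V] lies in [W] and contains [A], hence is all of [W]. *)
have [] : subsub U S (val x); last by move=> y Uy /val_inj <-.
apply: AP => [T _ [y Uy <-]|[n y] Ay|]; first exact/set_mem/(valP y).
  have Wy : subFI_pred W 'I_n y by apply/mem_set; exact: (AW _ Ay).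
  exists (exist _ y Wy : subFI_obj W 'I_n) => //.
  exact: (AU (existT _ n (exist _ y Wy : subFI_obj W 'I_n))).
exact/set_mem/(valP x).
Qed.
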